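(* The number of singular fibers is a complete invariant of the isomorphism class of a genus one Lefschetz fibration over $\mathbb{S}^2$; that is, two genus one Lefschetz fibrations over $\mathbb{S}^2$ are isomorphic if and only if they have the same number of singular fibers. Furthermore, the number of singular fibers of a genus one Lefschetz fibration over $\mathbb{S}^2$ is divisible by $12$.
   Context: Genus one Lefschetz fibrations over $\mathbb{S}^2$ are considered here with at least one singular fiber, exactly one critical point on each singular fiber, and all vanishing cycles homotopically essential (nonseparating) simple closed curves on the regular fiber $\mathbb{T}^2$. Their monodromy is a factorization of the identity into positive Dehn twists in $\mathrm{Mod}(\mathbb{T}^2)\cong\mathrm{SL}_2(\mathbb{Z})$ with one factor per singular fiber, where a positive Dehn twist is an element of the conjugacy class of $\begin{bmatrix}1&1\\0&1\end{bmatrix}$ in $\mathrm{SL}_2(\mathbb{Z})$; the paper works under the identification of isomorphism classes of these fibrations with such factorizations up to Hurwitz moves and global conjugation. *)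

(* Defs.v *)
From HB Require Import structures.
From Stdlib Require Import Relation_Operators.
From mathcomp Require Import all_boot all_order all_algebra all_fingroup.

Set Implicit Arguments.
Unset Strict Implicit.
Unset Printing Implicit Defensive.

Import GRing.Theory.
Local Open Scope ring_scope.

Record SL2Z := MkSL2Z { SL2Z_val :> 'M[int]_2; _ : \det SL2Z_val == 1 }.

HB.instance Definition _ := [isSub for SL2Z_val].
HB.instance Definition _ := [Choice of SL2Z by <:].

Lemma SL2Z_det (A : SL2Z) : \det (A : 'M_2) = 1.
Proof. by case: A => A /= /eqP. Qed.

Lemma SL2Z_unit (A : SL2Z) : (A : 'M_2) \in unitmx.
Proof. by rewrite unitmxE SL2Z_det unitr1. Qed.

Fact SL2Z_one_subproof : \det (1%:M : 'M[int]_2) == 1.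
Proof. by rewrite det1. Qed.

Fact SL2Z_mul_subproof (A B : SL2Z) : \det ((A : 'M_2) *m B) == 1.
Proof. by rewrite det_mulmx !SL2Z_det mulr1. Qed.

Fact SL2Z_inv_subproof (A : SL2Z) : \det (invmx (A : 'M_2)) == 1.
Proof. by rewrite det_inv SL2Z_det invr1. Qed.

Definition SL2Z_one := MkSL2Z SL2Z_one_subproof.
Definition SL2Z_mul A B := MkSL2Z (SL2Z_mul_subproof A B).
Definition SL2Z_inv A := MkSL2Z (SL2Z_inv_subproof A).

Fact SL2Z_mulA : associative SL2Z_mul.
Proof. by move=> A B C; apply: val_inj; rewrite /= mulmxA. Qed.

Fact SL2Z_mul1 : left_id SL2Z_one SL2Z_mul.
Proof. by move=> A; apply: val_inj; rewrite /= mul1mx. Qed.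

Fact SL2Z_muls1 : right_id SL2Z_one SL2Z_mul.
Proof. by move=> A; apply: val_inj; rewrite /= mulmx1. Qed.

Fact SL2Z_mulV : left_inverse SL2Z_one SL2Z_inv SL2Z_mul.
Proof. by move=> A; apply: val_inj; rewrite /= mulVmx ?SL2Z_unit. Qed.

Fact SL2Z_mulsV : right_inverse SL2Z_one SL2Z_inv SL2Z_mul.
Proof. by move=> A; apply: val_inj; rewrite /= mulmxV ?SL2Z_unit. Qed.

HB.instance Definition _ := isGroup.Build SL2Z
  SL2Z_mulA SL2Z_mul1 SL2Z_muls1 SL2Z_mulV SL2Z_mulsV.

Local Open Scope group_scope.

Definition twist_mx : 'M[int]_2 :=
  (\matrix_(i < 2, j < 2) (nth [::] [:: [:: 1; 1]; [:: 0; 1]] i)`_j)%R.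

Fact twist_mx_det : \det twist_mx == 1%R.
Proof.
by rewrite (expand_det_row _ ord0) !big_ord_recl big_ord0 /cofactor !det_mx11 !mxE.
Qed.

Definition twist : SL2Z := MkSL2Z twist_mx_det.

Definition positive_Dehn_twist (x : SL2Z) : Prop :=
  exists g : SL2Z, x = twist ^ g.

(* A genus one Lefschetz fibration over the sphere, represented by the sequence
   of its monodromies in Mod(T^2) = SL_2(Z), one positive Dehn twist for each
   singular fiber. *)
Record genus1_Lefschetz_fibration := Genus1LefschetzFibration {
  monodromy : seq SL2Z;
  monodromy_neq0 : monodromy != [::];
  monodromy_twist : forall x, x \in monodromy -> positive_Dehn_twist x;
  monodromy_prod : \prod_(x <- monodromy) x = 1
}.

Definition number_of_singular_fibers (F : genus1_Lefschetz_fibration) : nat :=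
  size (monodromy F).

(* Here x ^ y = y^-1 * x * y, so that x * y = y * x ^ y; the inverse Hurwitz
   moves come from the symmetric closure in [isomorphic]. *)
Inductive factorization_move (G : groupType) : seq G -> seq G -> Prop :=
| Hurwitz_move (s1 s2 : seq G) (x y : G) :
    factorization_move (s1 ++ [:: x, y & s2]) (s1 ++ [:: y, x ^ y & s2])
| Global_conjugation (s : seq G) (g : G) :
    factorization_move s [seq x ^ g | x <- s].

Definition isomorphic (F1 F2 : genus1_Lefschetz_fibration) : Prop :=
  clos_refl_sym_trans (seq SL2Z) (@factorization_move SL2Z)
    (monodromy F1) (monodromy F2).

(* Main.v *)
From Stdlib Require Import Relation_Operators.
From mathcomp Require Import all_boot all_order all_algebra all_fingroup.
From mathcomp Require Import ring lra zify.
Require Import Defs.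

(** Every factorization of the identity into positive twists is Hurwitz equivalent
    to (a, b, a, b, ..., a, b), where a and b are the twists along (1, 0) and
    (1, -1). The product a b is the matrix [rho], which has order six, so a
    factorization of the identity consists of m pairs with 6 dividing m: its
    length 2 m is divisible by 12, and the length determines the factorization
    up to Hurwitz moves.

    The normal form comes from an argument on the Farey tree. A positive twist is
    determined by a direction, a point of the rational projective line. The
    directions are the vertices of the Farey triangulation; [rho] rotates the base
    triangle, whose corners are (1, 0), (1, -1) and (0, 1). Any other direction is
    reached by a path that leaves the base triangle through one of its sides and
    then turns right or left, and the depth of a twist is the length of this path.
    A twist moves all directions the same way round the circle: it sends every
    point outside a certain Farey interval that starts at its direction into a
    Farey interval that ends there.

    Consider two adjacent factors. If the left direction lies inside the interval
    that ends at the right one, or the right direction inside the interval that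
    starts at the left one, a Hurwitz move decreases the depth of the inner factor
    ([shorten_right], [shorten_left]). Otherwise either the factors are twists along
    two consecutive corners, with product [rho], or the interval into which the
    right factor sends points has no interior point in common with the interval
    that the left factor pushes points out of ([not_apart_cases]). If the last
    alternative holds for all adjacent pairs of a nonempty sequence, ping-pong shows
    that the product sends all corners of the base triangle into one Farey interval
    ([apart_chain_region]), so it is not a power of [rho].

    Therefore a nonempty sequence whose product is a power of [rho] can be made
    shallower, or contains a pair of consecutive corners. Such a pair can be moved
    to the front, since passing it only rotates the other factors by [rho] and so
    preserves their depths, and all such pairs are Hurwitz equivalent. The rest
    again has a power of [rho] as product, and induction applies
    ([Hurwitz_standard]). *)

Set Implicit Arguments.
Unset Strict Implicit.
Unset Printing Implicit Defensive.
Import Order.TTheory GRing.Theory Num.Theory.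
Local Open Scope ring_scope.
Local Open Scope nat_scope.
Local Open Scope group_scope.

(** * The action of SL_2(Z) on integer vectors *)

Lemma SL2Z_mulE (A B : SL2Z) i j :
  (A * B) i j = (A i 0 * B 0 j + A i 1 * B 1 j)%R.
Proof.
rewrite [LHS]mxE !big_ord_recl big_ord0 addr0.
by congr (_ + A i _ * B _ j)%R; apply: val_inj.
Qed.

Lemma SL2Z_oneE i j : (1 : SL2Z) i j = (i == j)%:R%R.
Proof. by rewrite [LHS]mxE. Qed.

Lemma SL2Z_eq_entries (A B : SL2Z) :
  A 0%R 0%R = B 0%R 0%R -> A 0%R 1%R = B 0%R 1%R ->
  A 1%R 0%R = B 1%R 0%R -> A 1%R 1%R = B 1%R 1%R -> A = B.
Proof.
move=> h00 h01 h10 h11; apply/val_inj/matrixP => i j /=.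
have E (k : 'I_2) : k = 0%R \/ k = 1%R.
  by case: k => [[|[|//]] ?]; [left|right]; apply: val_inj.
by case: (E i) => ->; case: (E j) => ->.
Qed.

Lemma det_mx2 (R : comNzRingType) (A : 'M[R]_2) :
  (\det A = A 0 0 * A 1 1 - A 0 1 * A 1 0)%R.
Proof.
rewrite (expand_det_row _ 0%R) !big_ord_recl big_ord0 addr0 /cofactor !det_mx11 !mxE.
rewrite expr0 expr1 mul1r mulN1r mulrN.
by congr (_ * A _ _ - A _ _ * A _ _)%R; apply: val_inj.
Qed.

Definition mx2 (a b c d : int) : 'M[int]_2 :=
  (\matrix_(i, j) (if i == 0 then if j == 0 then a else b
                   else if j == 0 then c else d))%R.

Definition act (A : SL2Z) (p : int * int) : int * int :=
  (A 0 0 * p.1 + A 0 1 * p.2, A 1 0 * p.1 + A 1 1 * p.2)%R.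

Lemma actM A B p : act (A * B) p = act A (act B p).
Proof. by rewrite /act !SL2Z_mulE /=; congr (_, _); ring. Qed.

Lemma act1 p : act 1 p = p.
Proof. by rewrite /act !SL2Z_oneE /= !mul1r !mul0r addr0 add0r; case: p. Qed.

Lemma act_inj A : injective (act A).
Proof. by apply: (can_inj (g := act A^-1)) => p; rewrite -actM mulVg act1. Qed.

Lemma SL2Z_act_inj A B : act A =1 act B -> A = B.
Proof.
move=> h; move: (h (1, 0)%R) (h (0, 1)%R).
rewrite /act /= !mulr1 !mulr0 !addr0 !add0r => -[h1 h2] [h3 h4].
exact: SL2Z_eq_entries.
Qed.

(** * Rotation and flip of the base Farey triangle *)

Fact rho_det : \det (mx2 1 1 (- 1) 0)%R == 1%R.
Proof. by rewrite det_mx2 !mxE. Qed.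

(** The element of order six that rotates the base Farey triangle, whose corners
    are the directions of (1, 0), (1, -1) and (0, 1). *)
Definition rho : SL2Z := MkSL2Z rho_det.

Fact sigma_det : \det (mx2 0 (- 1) 1 0)%R == 1%R.
Proof. by rewrite det_mx2 !mxE. Qed.

(** The element of order four that flips the side from (1, 0) to (0, 1) of the
    base triangle. Together with [rho] it presents SL_2(Z) as the amalgam of
    Z/4 and Z/6 over the centre. *)
Definition sigma : SL2Z := MkSL2Z sigma_det.

Lemma act_twist p : act twist p = (p.1 + p.2, p.2)%R.
Proof. by rewrite /act !mxE /= !mul1r mul0r add0r. Qed.

Lemma act_rho p : act rho p = (p.1 + p.2, - p.1)%R.
Proof. by rewrite /act !mxE /= !mul1r mul0r addr0 mulN1r. Qed.

Lemma act_sigma p : act sigma p = (- p.2, p.1)%R.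
Proof. by rewrite /act !mxE /= !mul1r !mul0r add0r addr0 mulN1r. Qed.

Lemma act_sigma2 p : act (sigma ^+ 2) p = (- p.1, - p.2)%R.
Proof. by rewrite expg2 actM !act_sigma. Qed.

Lemma rho_exp3 : rho ^+ 3 = sigma ^+ 2.
Proof.
apply: SL2Z_act_inj => -[x y].
by rewrite act_sigma2 !expgS expg0 mulg1 !actM !act_rho /=; congr (_, _); ring.
Qed.

(** The central element -1 appears throughout as [sigma ^+ 2]; it acts trivially
    by conjugation, so signs of vectors never matter. *)
Lemma sigma2C A : commute (sigma ^+ 2) A.
Proof.
apply: SL2Z_act_inj => p.
by rewrite (actM _ A) (actM A) !act_sigma2 /act /=; congr (_, _); ring.
Qed.

Lemma sigma2_exp2 : sigma ^+ 2 * sigma ^+ 2 = 1.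
Proof.
apply: SL2Z_act_inj => -[x y].
by rewrite actM !act_sigma2 act1 /= !opprK.
Qed.

Lemma conj_sigma2 x : x ^ (sigma ^+ 2) = x.
Proof. by rewrite conjgE -sigma2C mulKg. Qed.

Lemma rho_mod i : rho ^+ i = (sigma ^+ 2) ^+ (i %/ 3) * rho ^+ (i %% 3).
Proof. by rewrite -rho_exp3 -expgnA mulnC -expgnDr -divn_eq. Qed.

(** The order of [rho] is exactly six. With two twists for each factor [rho], this
    is where the divisibility by 12 comes from. *)
Lemma rhoX_eq1 m : rho ^+ m = 1 -> 6 %| m.
Proof.
have r6 : rho ^+ 6 = 1 by rewrite (expgnA rho 3 2) rho_exp3 expg2 sigma2_exp2.
rewrite {1}(divn_eq m 6) mulnC expgnDr expgnA r6 expg1n mul1g /dvdn.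
have : m %% 6 < 6 by rewrite ltn_mod.
case: (m %% 6) => [//|k] k6 /(congr1 (act ^~ (1, 0)%R)).
by case: k k6 => [|[|[|[|[|?]]]]] // _; rewrite !expgS expg0 !actM act1 !act_rho.
Qed.

(** A flip after a rotation: the twist moves the base triangle to an adjacent one
    with the same fixed corner. *)
Lemma twistE : twist = sigma * rho ^+ 2.
Proof.
apply: SL2Z_act_inj => -[x y].
by rewrite expg2 !actM act_sigma !act_rho act_twist /=; congr (_, _); ring.
Qed.

Lemma twist_rho : twist * rho = sigma ^+ 2 * sigma.
Proof. by rewrite twistE -mulgA -expgSr rho_exp3 -expgS -expgSr. Qed.

Lemma twistVE : twist^-1 = rho * sigma.
Proof.
apply: (mulgI twist); rewrite mulgV mulgA twist_rho -(mulgA (sigma ^+ 2)).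
by rewrite -(expg2 sigma) sigma2_exp2.
Qed.

(** * Hurwitz equivalence in a group *)

(** Global conjugation is left out because it is not stable under concatenation
    with further factors. *)
Inductive Hurwitz_step (G : groupType) : seq G -> seq G -> Prop :=
| HurwitzStep (s1 s2 : seq G) (x y : G) :
    Hurwitz_step (s1 ++ [:: x, y & s2]) (s1 ++ [:: y, x ^ y & s2]).

Definition Hurwitz_equiv (G : groupType) :=
  clos_refl_sym_trans (seq G) (@Hurwitz_step G).

Lemma Hurwitz_refl (G : groupType) (s : seq G) : Hurwitz_equiv s s.
Proof. exact: rst_refl. Qed.

Lemma Hurwitz_sym (G : groupType) (s t : seq G) : Hurwitz_equiv s t -> Hurwitz_equiv t s.
Proof. exact: rst_sym. Qed.

Lemma Hurwitz_trans (G : groupType) (t s u : seq G) :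
  Hurwitz_equiv s t -> Hurwitz_equiv t u -> Hurwitz_equiv s u.
Proof. exact: rst_trans. Qed.

Lemma Hurwitz_cat (G : groupType) (s1 s t s2 : seq G) :
  Hurwitz_equiv s t -> Hurwitz_equiv (s1 ++ s ++ s2) (s1 ++ t ++ s2).
Proof.
elim=> {s t} [_ _ [t1 t2 x y]|s|s t _|s t u _ h1 _ h2].
- by rewrite -!catA /= !catA; apply/rst_step/HurwitzStep.
- exact: Hurwitz_refl.
- exact: Hurwitz_sym.
- exact: Hurwitz_trans h1 h2.
Qed.

Lemma Hurwitz_prod (G : groupType) (s t : seq G) :
  Hurwitz_equiv s t -> \prod_(x <- s) x = \prod_(x <- t) x.
Proof.
elim=> {s t} [_ _ [t1 t2 x y]|//|s t _ ->//|s t u _ -> _ -> //].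
by rewrite !big_cat !big_cons /= (mulgA x) (conjgC x) -(mulgA y).
Qed.

Lemma Hurwitz_size (G : groupType) (s t : seq G) :
  Hurwitz_equiv s t -> size s = size t.
Proof.
elim=> {s t} [_ _ [t1 t2 x y]|//|s t _ ->//|s t u _ -> _ -> //].
by rewrite !size_cat.
Qed.

Lemma Hurwitz_pass (G : groupType) (s : seq G) x t :
  Hurwitz_equiv (s ++ x :: t) (x :: [seq y ^ x | y <- s] ++ t).
Proof.
elim/last_ind: s t => [|s y IHs] t /=; first exact: Hurwitz_refl.
rewrite -cats1 -catA /=; apply: (@Hurwitz_trans _ (s ++ [:: x, y ^ x & t])).
  exact/rst_step/HurwitzStep.
by rewrite map_cat -catA.
Qed.

(** A block of two factors travels to the front at the price of conjugating what
    it passes by the product of the block. *)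
Lemma Hurwitz_pass_pair (G : groupType) (s : seq G) a b t :
  Hurwitz_equiv (s ++ [:: a, b & t]) ([:: a; b] ++ [seq x ^ (a * b) | x <- s] ++ t).
Proof.
apply: Hurwitz_trans (Hurwitz_pass _ _ _) _.
have := Hurwitz_cat [:: a] [::] (Hurwitz_pass [seq y ^ a | y <- s] b t).
rewrite !cats0 -map_comp; congr Hurwitz_equiv => /=.
by congr [:: _, _ & _ ++ _]; apply: eq_map => x /=; rewrite conjgM.
Qed.

(** * Twists as paths in the Farey tree *)

(** [letter true] is the matrix R with rows (1, 0), (1, 1) and [letter false] is
    the matrix L with rows (1, 1), (0, 1): the two ways to go on in the Farey
    tree after entering a triangle, mapping the positive quadrant onto its two
    halves. *)
Definition letter (b : bool) : SL2Z := if b then sigma * rho else twist.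

Lemma letterE b : letter b = sigma * rho ^+ (if b then 1 else 2)%N.
Proof. by case: b => //; exact: twistE. Qed.

Lemma sigma_letter b : sigma * letter b = sigma ^+ 2 * rho ^+ (if b then 1 else 2)%N.
Proof. by rewrite letterE mulgA -expg2. Qed.

Lemma twistV_letter b : twist^-1 * letter b = sigma ^+ 2 * rho ^+ (if b then 2 else 3)%N.
Proof.
have -> : letter b = twist * (sigma ^+ 2 * rho ^+ (if b then 2 else 3)%N).
  rewrite mulgA -sigma2C -mulgA.
  have -> : rho ^+ (if b then 2 else 3)%N = rho * rho ^+ (if b then 1 else 2)%N.
    by case: b; rewrite -expgS.
  rewrite (mulgA twist) twist_rho -(mulgA (sigma ^+ 2) sigma).
  by rewrite (mulgA (sigma ^+ 2) (sigma ^+ 2)) sigma2_exp2 mul1g letterE.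
by rewrite mulKg.
Qed.

(** The twist along the curve of direction [act g (1, 0)]. *)
Definition twist_along g : SL2Z := twist ^ g^-1.

Lemma twist_alongM g h : twist_along (g * h) = twist_along h ^ g^-1.
Proof. by rewrite /twist_along invMg conjgM. Qed.

Lemma twist_along_sign g h :
  twist_along (g * (sigma ^+ 2 * h)) = twist_along (g * h).
Proof. by rewrite mulgA -sigma2C -mulgA twist_alongM -[LHS]conj_sigma2 conjgKV. Qed.

Lemma twist_along_sign1 h : twist_along (sigma ^+ 2 * h) = twist_along h.
Proof. by have := twist_along_sign 1 h; rewrite !mul1g. Qed.

Lemma twist_along_signX k h : twist_along ((sigma ^+ 2) ^+ k * h) = twist_along h.
Proof.
elim: k => [|k IHk]; first by rewrite expg0 mul1g.
by rewrite expgS -mulgA twist_along_sign1.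
Qed.

Lemma conj_twist_along g h :
  twist_along (g * h) ^ twist_along g = twist_along (g * (twist^-1 * h)).
Proof. by rewrite !twist_alongM invgK -conjJg. Qed.

Lemma conjV_twist_along g h :
  twist_along (g * h) ^ (twist_along g)^-1 = twist_along (g * (twist * h)).
Proof. by rewrite !twist_alongM {2}/twist_along -conjVg -conjJg. Qed.

(** A word (i, u) is a path in the Farey tree: the base triangle is left through
    the side number i modulo 3, and u lists the turns. The exponent i is a
    natural number rather than a residue, so that [word_elt] needs no
    normalization; [word_twist_mod] is the resulting periodicity. *)
Definition word := (nat * seq bool)%type.

Definition word_elt (w : word) : SL2Z := rho ^+ w.1 * \prod_(b <- w.2) letter b.

Lemma word_elt_cat i u w :
  word_elt (i, u ++ w) = word_elt (i, u) * \prod_(b <- w) letter b.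
Proof. by rewrite /word_elt big_cat /= mulgA. Qed.

Definition word_twist w := twist_along (word_elt w).

Lemma word_twist_mod i j w :
  i = j %[mod 3] -> word_twist (i, w) = word_twist (j, w).
Proof.
move=> e; rewrite /word_twist /word_elt /= (rho_mod i) (rho_mod j) e.
by rewrite -!mulgA !twist_along_signX.
Qed.

Lemma word_twist_rcons_false i w :
  word_twist (i, rcons w false) = word_twist (i, w).
Proof.
rewrite /word_twist -cats1 word_elt_cat big_seq1 twist_alongM.
by rewrite [twist_along _]conjgE invgK mulgV mulg1.
Qed.

(** Since [rho ^+ 3] is central, conjugating by [rho] is conjugating by the
    inverse of [rho ^+ 2]. *)
Lemma word_twist_conj_rho w : word_twist w ^ rho = word_twist (w.1.+2, w.2).
Proof.
rewrite {2}/word_twist /word_elt (expgnDr rho 2 w.1) -mulgA twist_alongM.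
apply: (@conjg_inj _ (rho ^+ 2)).
by rewrite conjgKV -conjgM -expgS rho_exp3 conj_sigma2.
Qed.

(** Words need not be reduced: the existence of a word of a given length is all
    that the induction uses, and the exact distance in the tree is never
    computed. *)
Definition depth_le n x := exists2 w : word, size w.2 <= n & x = word_twist w.

Lemma depth_le_rho n x : depth_le n x -> depth_le n (x ^ rho^-1).
Proof.
by case=> -[i w] /= sw ->; exists (i.+1, w); rewrite // -twist_alongM mulgA -expgS.
Qed.

Lemma depth_le_rhoX n x k : depth_le n x -> depth_le n (x ^ (rho ^+ k)^-1).
Proof.
move=> hx; elim: k => [|k IHk]; first by rewrite expg0 invg1 conjg1.
by rewrite expgS invMg conjgM; apply: depth_le_rho.
Qed.

(** Flipping one side of the base triangle changes distances to it by at most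
    one. *)
Lemma depth_le_sigma n x : depth_le n x -> depth_le n.+1 (x ^ sigma^-1).
Proof.
case=> -[i w] /= sw ->.
have -> : word_twist (i, w) = word_twist (i %% 3, w)%N.
  by apply: word_twist_mod; rewrite modn_mod.
rewrite -twist_alongM /word_elt /=.
(* Beyond the side flipped by sigma, the first letter cancels up to a rotation.
   Any other direction is flipped to one beyond that side, at the price of one
   more letter. *)
have : i %% 3 < 3 by rewrite ltn_mod.
case: (i %% 3) => [|[|[|//]]] _; last 2 first.
- exists (0%N, true :: w); rewrite ?ltnS //.
  by rewrite /word_twist /word_elt /= big_cons mul1g mulgA.
- exists (0%N, false :: w); rewrite ?ltnS //.
  by rewrite /word_twist /word_elt /= big_cons mul1g mulgA letterE.
rewrite mul1g; case: w sw => [|b w] /= sw.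
  exists (2%N, [::]) => //; rewrite /word_twist /word_elt !big_nil /= !mulg1.
  rewrite -[sigma](mulgK twist) (sigma_letter false) -mulgA twist_along_sign1.
  by rewrite [LHS]twist_alongM /twist_along invgK [twist ^ _]conjgE mulKg.
exists ((if b then 1 else 2)%N, w); first by apply: leq_trans (leqW sw).
rewrite big_cons mulgA sigma_letter -mulgA twist_along_sign1.
by rewrite /word_twist /word_elt /=; case: b.
Qed.

Lemma depth_le_letter n x b :
  depth_le n x -> depth_le n.+1 (x ^ (letter b)^-1).
Proof.
by move=> hx; rewrite letterE invMg conjgM; apply/depth_le_sigma/depth_le_rhoX.
Qed.

(** The triangle inequality in the tree. *)
Lemma depth_le_word n x w :
  depth_le n x -> depth_le (n + size w.2) (x ^ (word_elt w)^-1).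
Proof.
move=> hx; rewrite /word_elt invMg conjgM; apply: depth_le_rhoX.
elim: w.2 n x hx => [|b u IHu] n x hx.
  by rewrite big_nil invg1 conjg1 addn0.
by rewrite big_cons invMg conjgM addnS; apply/depth_le_letter/IHu.
Qed.

(** * Every positive twist is given by a path *)

(** Coverage by words is a property of the direction alone, which lets the
    Euclidean algorithm run on pairs of integers instead of matrices. *)
Definition direction_covered p :=
  forall g, act g (1, 0)%R = p -> exists n, depth_le n (twist_along g).

Lemma direction_covered_step h p :
  (forall n x, depth_le n x -> exists m, depth_le m (x ^ h)) ->
  direction_covered (act h p) -> direction_covered p.
Proof.
move=> hh hp g eg; have [|n /hh] := hp (h * g); first by rewrite actM eg.
by rewrite twist_alongM conjgKV.
Qed.

Lemma direction_covered_rotate x y :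
  direction_covered (- y, x)%R -> direction_covered (x, y).
Proof.
rewrite -[(- y, x)%R](act_sigma (x, y)).
apply: direction_covered_step => n z hz; exists n.+1.
have -> : z ^ sigma = z ^ sigma^-1; last exact: depth_le_sigma.
by rewrite -[z ^ sigma^-1]conj_sigma2 -conjgM mulKg.
Qed.

Lemma direction_covered_shear x y (k : int) :
  direction_covered (x + k * y, y)%R -> direction_covered (x, y).
Proof.
elim/int_rect: k x => [|k IHk|k IHk] x; first by rewrite mul0r addr0.
  move=> h; apply: IHk; move: h.
  have -> : (x + k.+1%:Z * y, y)%R = act twist (x + k%:Z * y, y)%R.
    by rewrite act_twist /=; congr (_, _); lia.
  apply: direction_covered_step => n z hz; exists n.+1.
  rewrite -[twist]invgK twistVE invMg conjgM.
  exact/depth_le_rho/depth_le_sigma.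
move=> h; apply: IHk; move: h.
have -> : (x + - k.+1%:Z * y, y)%R = act twist^-1 (x + - k%:Z * y, y)%R.
  apply: (@act_inj twist); rewrite -actM mulgV act1 act_twist /=.
  by congr (_, _); lia.
apply: direction_covered_step => n z hz; exists n.+1.
exact: (@depth_le_letter _ _ false).
Qed.

(** A matrix fixing the direction of (1, 0) is upper triangular with equal
    diagonal entries, so it commutes with [twist]. *)
Lemma direction_covered_axis x : direction_covered (x, 0)%R.
Proof.
move=> g eg; exists 0, (0, [::]) => //.
move: eg; rewrite /act /= !mulr1 !mulr0 !addr0 => -[e00 e10].
have d := SL2Z_det g; rewrite det_mx2 e10 mulr0 subr0 in d.
have e11 : g 0%R 0%R = g 1%R 1%R.
  move: (congr1 absz d) => /eqP; rewrite abszM muln_eq1 => /andP[/eqP a1 /eqP b1].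
  by move: d a1 b1; move: (g 0%R 0%R) (g 1%R 1%R) => a b; clear; nia.
have gC : commute twist g.
  by apply: SL2Z_eq_entries; rewrite !SL2Z_mulE !mxE /= ?e10 ?e11; ring.
have -> : twist_along g = twist.
  by rewrite /twist_along conjgE invgK mulgA -gC mulgK.
by rewrite /word_twist /word_elt big_nil mulg1 /twist_along invg1 conjg1.
Qed.

(** By the Euclidean algorithm the flips and shears bring every primitive vector
    to the horizontal axis, and each of them preserves coverage by words. *)
Lemma depth_le_conj_twist g : exists n, depth_le n (twist ^ g).
Proof.
have -> : twist ^ g = twist_along g^-1 by rewrite /twist_along invgK.
suff covered p : direction_covered p by exact: covered erefl.
case: p => x y; move: (leqnn `|y|%N); move: {2}`|y|%N => n.
elim: n x y => [|n IHn] x y.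
  by rewrite leqn0 absz_eq0 => /eqP->; apply: direction_covered_axis.
move=> yn; have [y0|y0] := eqVneq y 0%R; first by apply: IHn; rewrite y0.
(* One Euclidean step: the shear replaces x by its remainder modulo y, and the
   quarter turn makes that remainder the second coordinate. *)
apply: (@direction_covered_shear x y (- (x %/ y)%Z)).
apply: direction_covered_rotate; apply: IHn.
rewrite mulNr -/(modz x y).
have := ltz_mod x y0; have := modz_ge0 x y0.
by move: (x %% y)%Z => r; move: yn; clear; rewrite -abszE; lia.
Qed.

Lemma Dehn_twists_words (s : seq SL2Z) :
    (forall x, x \in s -> positive_Dehn_twist x) ->
  exists ws, s = map word_twist ws.
Proof.
elim: s => [|x s IHs] hs; first by exists [::].
have [|ws ->] := IHs; first by move=> y ys; apply: hs; rewrite inE ys orbT.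
have [|g ->] := hs x; first exact: mem_head.
by have [n [w _ ->]] := depth_le_conj_twist g; exists (w :: ws).
Qed.

(** * Hurwitz moves that shorten paths *)

(** If the path of the left factor of an adjacent pair continues the path of the
    right factor, the left factor lies on the attracting side of the right one.
    Untwisting it slides it one step along the horocycle, back toward the base
    triangle: [twist^-1] times a letter is a rotation up to sign. *)
Lemma shorten_right i w b u :
  depth_le (size w + size u) (word_twist (i, w ++ b :: u) ^ word_twist (i, w)).
Proof.
rewrite /word_twist word_elt_cat big_cons conj_twist_along (mulgA twist^-1).
rewrite twistV_letter -(mulgA (sigma ^+ 2)) twist_along_sign twist_alongM addnC.
by apply: (depth_le_word (i, w)); exists ((if b then 2 else 3)%N, u).
Qed.

(** The mirror situation: the right factor lies on the side from which the left
    twist pushes points away, and twisting brings it nearer, because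
    [twist * rho] times a letter is again a rotation up to sign. *)
Lemma shorten_left v b u x :
    x = twist_along (word_elt v * rho * (letter b * \prod_(c <- u) letter c)) ->
  depth_le (size v.2 + size u) (x ^ (word_twist v)^-1).
Proof.
move=> ->; rewrite -mulgA conjV_twist_along (mulgA twist) twist_rho.
rewrite -(mulgA _ sigma) (mulgA sigma) sigma_letter -(mulgA (sigma ^+ 2)).
rewrite (mulgA (sigma ^+ 2) (sigma ^+ 2)) sigma2_exp2 mul1g.
by rewrite twist_alongM addnC; apply: depth_le_word; exists ((if b then 1 else 2)%N, u).
Qed.

(** The twist along the direction v = [act (word_elt w) (1, 0)] fixes v and moves
    all other directions the same way round the circle. The image of the quadrant
    under [word_elt w] is a Farey interval that ends at v, its image under
    [word_elt w * rho] a Farey interval that starts at v, and the twist sends all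
    points outside the second interval into the first one. The word below
    describes the second interval: for a corner it is the next side, and for any
    other direction the last turn is reversed. *)
Definition repelling_word (w : word) : word :=
  if w.2 is [::] then (w.1.+1, [::])
  else (w.1, rcons (take (size w.2).-1 w.2) false).

(** A word that is empty or ends with R. A trailing L would not change the
    direction, but it would change the image of the quadrant. *)
Definition normal (w : word) := last true w.2.

Lemma repelling_word_rcons i u :
  repelling_word (i, rcons u true) = (i, rcons u false).
Proof.
case: u => //= a u.
by rewrite /repelling_word /= size_rcons /= -!cats1 take_size_cat.
Qed.

Lemma size_repelling_word w : normal w -> size (repelling_word w).2 = size w.2.
Proof.
case: w => i w; case/lastP: w => // w c.
by rewrite /normal last_rcons => ->; rewrite repelling_word_rcons !size_rcons.
Qed.

Lemma word_elt_repelling w : normal w -> word_elt (repelling_word w) = word_elt w * rho.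
Proof.
case: w => i w; case/lastP: w => [|u b].
  move=> _; rewrite /word_elt /= big_nil !mulg1; by rewrite expgSr.
rewrite /normal /= last_rcons => ->; rewrite repelling_word_rcons.
rewrite -!cats1 !word_elt_cat !big_seq1.
have -> : letter false = letter true * rho by rewrite /= twistE expg2 mulgA.
by rewrite mulgA.
Qed.

Definition comparable (a b : word) :=
  (a.1 == b.1 %[mod 3]) && (prefix a.2 b.2 || prefix b.2 a.2).

(** The attracting interval of v avoids the interior of the repelling interval of
    v', so that the twist of v' can be applied after the twist of v in the
    ping-pong argument. *)
Definition apart (v' v : word) := ~~ comparable v (repelling_word v').

(** When two adjacent factors are not in ping-pong position, one path continues
    the other, and then a Hurwitz move shortens one of them; the exception is a
    pair of consecutive corners. *)
Lemma not_apart_cases x y : normal x -> normal y -> ~~ apart x y ->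
  [\/ exists i, word_twist x = word_twist (i, [::]) /\
                word_twist y = word_twist (i.+1, [::]),
      exists2 n, n < size x.2 & depth_le n (word_twist x ^ word_twist y)
    | exists2 n, n < size y.2 & depth_le n (word_twist y ^ (word_twist x)^-1)].
Proof.
case: x y => [i w] [j u] nx ny;
rewrite /apart negbK /comparable => /andP[/eqP ij pre].
have eb : word_twist (j, u) = word_twist ((repelling_word (i, w)).1, u).
  exact: word_twist_mod.
have [/prefixP[[|c t] e]|] := boolP (prefix (repelling_word (i, w)).2 u).
(* Equal words: one ends in L and the other in R unless both are empty. *)
- move: eb e ny; rewrite cats0 => eb.
  case/lastP: w nx eb {ij pre} => [|w c] nx eb e ny.
    by apply: Or31; exists i; rewrite eb e.
  move: nx e ny; rewrite /normal /= last_rcons => ->.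
  by rewrite repelling_word_rcons /= => ->; rewrite last_rcons.
- apply: Or33; exists (size w + size t).
    by rewrite /= e size_cat size_repelling_word //= addnS.
  apply: (@shorten_left (i, w) c); rewrite -word_elt_repelling // eb e.
  by rewrite /word_twist word_elt_cat big_cons; case: (repelling_word _).
- case/orP: pre => [/prefixP[t e] nbu|->//].
  case/lastP: w nx eb e nbu {ij} => [|w c] nx; first by rewrite prefix0s.
  move: nx; rewrite /normal last_rcons => ->; rewrite repelling_word_rcons /= => ->.
  (* A proper prefix of rcons w false is also one of rcons w true, which is the
     word of x. *)
  case/lastP: t => [-> | t d]; first by rewrite cats0 prefix_refl.
  rewrite -rcons_cat => /rcons_inj[-> _] _; apply: Or32.
  rewrite rcons_cat; case E : (rcons t true) => [|c' t']; first by case: t E.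
  exists (size u + size t'); first by rewrite /= size_cat /= addnS.
  exact: shorten_right.
Qed.

(** * Ping-pong on Farey intervals *)

(** The sign of the product of the coordinates is insensitive to negating the
    vector, so both quadrants are really arcs of the projective line. *)
Definition closed_quadrant (p : int * int) := (0 <= p.1 * p.2)%R.

Definition open_quadrant (p : int * int) := (0 < p.1 * p.2)%R.

Lemma act_letter_true p : act (letter true) p = (p.1, p.1 + p.2)%R.
Proof. by rewrite actM act_sigma act_rho /= opprK. Qed.

Lemma closed_quadrant_letters u p :
  closed_quadrant p ->
  closed_quadrant (act (\prod_(b <- u) letter b) p).
Proof.
move=> hp; elim: u => [|b u]; first by rewrite big_nil act1.
rewrite big_cons actM; case: (act _ p) => x y; rewrite /closed_quadrant.
case: b; rewrite ?act_letter_true ?act_twist /=; nra.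
Qed.

Lemma open_quadrant_letters u p :
  open_quadrant p ->
  open_quadrant (act (\prod_(b <- u) letter b) p).
Proof.
move=> hp; elim: u => [|b u]; first by rewrite big_nil act1.
rewrite big_cons actM; case: (act _ p) => x y; rewrite /open_quadrant.
case: b; rewrite ?act_letter_true ?act_twist /=; nra.
Qed.

(** Farey intervals reached by paths that separate have disjoint interiors: the
    two letters map the quadrant onto halves that only share a ray. *)
Lemma letters_comparable a b p q :
    act (\prod_(c <- a) letter c) p = act (\prod_(c <- b) letter c) q ->
  closed_quadrant p -> open_quadrant q -> prefix a b || prefix b a.
Proof.
move=> e hp hq; elim: a b e => [|x a IHa] [|y b] //=.
rewrite !big_cons !actM.
have := closed_quadrant_letters a hp; have := open_quadrant_letters b hq.
have [<- _ _ /act_inj/IHa //|] := eqVneq x y.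
move: (act _ p) (act _ q) => [p1 p2] [q1 q2].
rewrite /open_quadrant /closed_quadrant.
case: x; case: y; rewrite // ?act_letter_true ?act_twist /= => _ hQ hC [e1 e2].
  have E1 : p1 = (q1 + q2)%R by lia.
  have E2 : p2 = (- q1)%R by lia.
  by exfalso; clear e1 e2; subst p1 p2; nra.
have E1 : q1 = (p1 + p2)%R by lia.
have E2 : q2 = (- p1)%R by lia.
by exfalso; clear e1 e2; subst q1 q2; nra.
Qed.

Lemma act_signX k p :
  act ((sigma ^+ 2) ^+ k) p = p \/ act ((sigma ^+ 2) ^+ k) p = act (sigma ^+ 2) p.
Proof.
elim: k => [|k [] IHk]; rewrite ?act1; first by left.
  by right; rewrite expgS actM IHk.
by left; rewrite expgS actM IHk -actM sigma2_exp2 act1.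
Qed.

Lemma act_rho_mod i p : exists k,
  act (rho ^+ i) p = act (rho ^+ (i %% 3)) (act ((sigma ^+ 2) ^+ k) p).
Proof.
exists (i %/ 3); rewrite rho_mod -actM; congr act.
by apply/commute_sym/commuteX; apply/commute_sym/sigma2C.
Qed.

Lemma closed_quadrantN p k :
  closed_quadrant (act ((sigma ^+ 2) ^+ k) p) = closed_quadrant p.
Proof.
by have [->|->] := act_signX k p; rewrite // act_sigma2 /closed_quadrant /= mulrNN.
Qed.

Lemma open_quadrantN p k :
  open_quadrant (act ((sigma ^+ 2) ^+ k) p) = open_quadrant p.
Proof.
by have [->|->] := act_signX k p; rewrite // act_sigma2 /open_quadrant /= mulrNN.
Qed.

(** The three rotations of the quadrant cover the projective line and overlap
    only in the corners of the base triangle. *)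
Lemma sector_mod i j p q :
  act (rho ^+ i) p = act (rho ^+ j) q -> closed_quadrant p ->
  open_quadrant q -> i = j %[mod 3].
Proof.
have [k ->] := act_rho_mod i p; have [l ->] := act_rho_mod j q.
rewrite -(closed_quadrantN p k) -(open_quadrantN q l).
move: (act _ p) (act _ q) => {k l} [p1 p2] [q1 q2].
have : i %% 3 < 3 by rewrite ltn_mod.
have : j %% 3 < 3 by rewrite ltn_mod.
rewrite /closed_quadrant /open_quadrant.
case: (i %% 3) => [|[|[|?]]] //; case: (j %% 3) => [|[|[|?]]] //;
rewrite ?expg0 ?expg1 ?expg2 ?act1 ?actM !act_rho /= => _ _ [e1 e2] hp hq; exfalso.
all: try (subst p1 p2; nra).
all: try (subst q1 q2; nra).
  have E1 : p1 = (q1 + q2)%R by lia.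
  have E2 : p2 = (- q1)%R by lia.
  by clear e1 e2; subst p1 p2; nra.
have E1 : q1 = (p1 + p2)%R by lia.
have E2 : q2 = (- p1)%R by lia.
by clear e1 e2; subst q1 q2; nra.
Qed.

Lemma sector_sign i j p q :
    i = j %[mod 3] -> act (rho ^+ i) p = act (rho ^+ j) q ->
  exists k, p = act ((sigma ^+ 2) ^+ k) q.
Proof.
have [k ->] := act_rho_mod i p; have [l ->] := act_rho_mod j q.
move=> -> /act_inj e; exists (k + l).
rewrite expgnDr actM -e -actM -expgMn // sigma2_exp2 expg1n act1 //.
Qed.

Lemma regions_comparable a b p q :
    act (word_elt a) p = act (word_elt b) q ->
  closed_quadrant p -> open_quadrant q -> comparable a b.
Proof.
rewrite /word_elt !actM => e hp hq.
have em :=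
  sector_mod e (closed_quadrant_letters a.2 hp) (open_quadrant_letters b.2 hq).
rewrite /comparable em eqxx /=.
have [k {}e] := sector_sign em e.
apply: (letters_comparable (q := act ((sigma ^+ 2) ^+ k) q)) hp _; last first.
  by rewrite open_quadrantN.
rewrite e -!actM; congr act.
by apply/commute_sym/commuteX; apply/commute_sym/sigma2C.
Qed.

(** The ping-pong step. In the coordinates where the twist is the standard one,
    [twist = sigma ^+ 2 * sigma * rho^-1], and the quarter turn [sigma] exchanges
    the open quadrant with the complement of the closed one. *)
Lemma twist_attracts v q :
    (forall r, open_quadrant r -> q <> act (word_elt v * rho) r) ->
  exists2 r, closed_quadrant r & act (word_twist v) q = act (word_elt v) r.
Proof.
move=> hq; exists (act (twist * (word_elt v)^-1) q); last first.
  by rewrite -actM /word_twist /twist_along conjgE invgK.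
have := hq (act (word_elt v * rho)^-1 q).
rewrite -actM mulgV act1 => /(_ _ erefl) h.
have {h}: ~~ open_quadrant (act (word_elt v * rho)^-1 q) by apply/negP.
have -> : twist * (word_elt v)^-1 = twist * rho * (word_elt v * rho)^-1.
  by rewrite (invMg (word_elt v)) -(mulgA twist) mulVKg.
rewrite twist_rho actM; case: (act _ q) => x y.
by rewrite actM act_sigma act_sigma2 /open_quadrant /closed_quadrant /=; nra.
Qed.

(** The corners of the base triangle lie in the interior of no Farey interval given
    by a word, so ping-pong may start with the twist of any word. *)
Lemma corner_not_open j w r :
  open_quadrant r -> act (rho ^+ j) (1, 0)%R <> act (word_elt w) r.
Proof.
move=> hr; rewrite /word_elt actM => e.
have hl := open_quadrant_letters w.2 hr.
have [k e'] := sector_sign (sector_mod (p := (1, 0)%R) e isT hl) e.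
by rewrite -(open_quadrantN _ k) -e' in hl.
Qed.

Lemma apart_chain_region v s j : path apart v s -> all normal (v :: s) ->
  exists2 r, closed_quadrant r &
    act (\prod_(x <- map word_twist (v :: s)) x) (act (rho ^+ j) (1, 0)%R)
    = act (word_elt v) r.
Proof.
elim: s v => [|u s IHs] v /=.
  rewrite big_seq1 andbT => _ nv; apply: twist_attracts => r hr.
  by rewrite -word_elt_repelling //; apply: corner_not_open.
case/andP=> avu pus /and3P[nv nu ns].
have [|r hr e] := IHs _ pus; first by rewrite /= nu.
rewrite big_cons actM e; apply: twist_attracts => r' hr'.
rewrite -word_elt_repelling // => e'.
by move: avu; rewrite /apart (regions_comparable e').
Qed.

(** Ping-pong sends all three corners into one rotated quadrant, which contains
    only two of them, whereas a power of [rho] permutes them. *)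
Lemma apart_chain_not_rotation v s k : path apart v s -> all normal (v :: s) ->
  rho ^+ k * \prod_(x <- map word_twist (v :: s)) x <> 1.
Proof.
(* The corner is chosen so that after cancelling the product against rho ^+ k
   and the rotation rho ^+ v.1 of the region, the corner act rho (1, 0), which
   is (1, -1), would lie in the closed quadrant. *)
move=> pvs ns; have [r hr] := apart_chain_region (k + v.1.+1) pvs ns.
move: (\prod_(x <- _) x) => P e e1.
have {}e1 : P * rho ^+ k = 1.
  by rewrite -[_ * _](mulgK P) -(mulgA P) e1 mulg1 mulgV.
move: e; rewrite expgnDr actM -(actM P) e1 act1 /word_elt expgSr !actM => /act_inj e.
by have := closed_quadrant_letters v.2 hr; rewrite -e act_rho.
Qed.

(** * Reduction to the standard factorization *)

Lemma not_sortedP (T : Type) (e : rel T) s : ~~ sorted e s ->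
  exists s1 x y s2, s = s1 ++ [:: x, y & s2] /\ ~~ e x y.
Proof.
elim: s => [//|x [//|y s] IHs] /=.
rewrite negb_and => /orP[nxy|/IHs [s1 [x' [y' [s2 [-> nxy]]]]]].
  by exists [::], x, y, s.
by exists (x :: s1), x', y', s2.
Qed.

(** Twists along two consecutive corners of the base triangle, that is, along two
    curves meeting once. *)
Definition corner_pair i := [:: word_twist (i, [::]); word_twist (i.+1, [::])].

Lemma mul_corner_pair i :
  word_twist (i, [::]) * word_twist (i.+1, [::]) = rho.
Proof.
have e j : word_twist (j, [::]) = twist ^ (rho ^+ j)^-1.
  by rewrite /word_twist /word_elt big_nil mulg1.
rewrite !e expgSr invMg conjgM -conjMg.
have -> : twist * twist ^ rho^-1 = rho.
  rewrite conjgE invgK (mulgA twist) twist_rho twistE expg2.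
  rewrite (mulgA sigma) mulgK -(mulgA (sigma ^+ 2)) (mulgA sigma) -expg2.
  by rewrite mulgA sigma2_exp2 mul1g.
by rewrite conjgE invgK mulgA -expgSr expgS mulgK.
Qed.

Lemma prod_corner_pair i : \prod_(x <- corner_pair i) x = rho.
Proof. by rewrite big_cons big_seq1 mul_corner_pair. Qed.

(** A Hurwitz move keeps the product [rho] and puts the second twist first, so the
    new second twist is forced to be the one along the next corner. *)
Lemma Hurwitz_corner_pair i : Hurwitz_equiv (corner_pair i) (corner_pair 0).
Proof.
elim: i => [|i IHi]; first exact: Hurwitz_refl.
apply: Hurwitz_trans IHi; apply: Hurwitz_sym; apply: rst_step.
have := @HurwitzStep _ [::] [::] (word_twist (i, [::])) (word_twist (i.+1, [::])).
rewrite conjgE mul_corner_pair -(mul_corner_pair i.+1) mulKg; exact.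
Qed.

Definition standard_factorization m : seq SL2Z := flatten (nseq m (corner_pair 0)).

Lemma prod_standard m : \prod_(x <- standard_factorization m) x = rho ^+ m.
Proof.
elim: m => [|m IHm]; first by rewrite big_nil.
by rewrite /standard_factorization /= !big_cons IHm mulgA mul_corner_pair expgS.
Qed.

Lemma size_standard m : size (standard_factorization m) = (2 * m)%N.
Proof.
elim: m => //= m IHm.
by rewrite /standard_factorization /= -/(standard_factorization m) IHm; lia.
Qed.

(** Each factor counts at least once, so that splitting off a pair of corners,
    which has depth zero, also makes the measure smaller. *)
Definition total_depth (s : seq word) := size s + sumn [seq size w.2 | w <- s].

Lemma total_depth_cat s t : total_depth (s ++ t) = total_depth s + total_depth t.
Proof. by rewrite /total_depth map_cat sumn_cat size_cat; lia. Qed.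

Lemma total_depth_cons w s : total_depth (w :: s) = (size w.2).+1 + total_depth s.
Proof. by rewrite /total_depth /=; lia. Qed.

(** The product is allowed to be any power of [rho], not only 1, because splitting
    off a pair of corners divides it by [rho]. If some adjacent pair is not in
    ping-pong position, a Hurwitz move decreases [total_depth] or a pair of
    corners splits off; otherwise ping-pong forces the sequence to be empty. *)
Lemma Hurwitz_standard n ws k :
    total_depth ws <= n ->
  rho ^+ k * \prod_(x <- map word_twist ws) x = 1 ->
  exists m, Hurwitz_equiv (map word_twist ws) (standard_factorization m).
Proof.
elim: n ws k => [|n IHn] ws k.
  by case: ws => // _ _; exists 0; apply: Hurwitz_refl.
move=> sn e1.
have IHs ws' : total_depth ws' < total_depth ws ->
    Hurwitz_equiv (map word_twist ws) (map word_twist ws') ->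
    exists m, Hurwitz_equiv (map word_twist ws) (standard_factorization m).
  move=> sn' eqv; have [||m eqm] := IHn ws' k.
  - by rewrite -ltnS; apply: leq_trans sn' sn.
  - by rewrite -(Hurwitz_prod eqv).
  by exists m; apply: Hurwitz_trans eqv eqm.
have [ns|/allPn[w w_ws nnw]] := boolP (all normal ws); last first.
  (* A final L is absorbed, since L fixes the direction (1, 0). *)
  case/splitPr: w_ws sn e1 IHs => w1 w2 sn e1 IHs.
  case: w nnw sn e1 IHs => i w; rewrite /normal /=; case/lastP: w => // w c.
  rewrite last_rcons => /negPf-> {c} sn e1 IHs.
  apply: (IHs (w1 ++ (i, w) :: w2)).
    by rewrite !total_depth_cat !total_depth_cons /= size_rcons; lia.
  by rewrite !map_cat /= word_twist_rcons_false; apply: Hurwitz_refl.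
have [sorted_ws|] := boolP (sorted apart ws).
  case: ws sn e1 ns sorted_ws {IHs} => [|v s] sn e1 ns pvs.
    by exists 0; apply: Hurwitz_refl.
  by case: (apart_chain_not_rotation pvs ns e1).
case/not_sortedP=> [w1 [x [y [w2 [ews napart]]]]].
have [nx ny] : normal x /\ normal y.
  by move: ns; rewrite ews all_cat /= => /and4P[].
case: (not_apart_cases nx ny napart).
(* The pair has product rho, so the factors which it passes on its way to the
   front are only rotated: their depths do not change. *)
- move=> [i [ex ey]].
  pose ws' := [seq (w.1.+2, w.2) | w <- w1] ++ w2.
  have eqv :
    Hurwitz_equiv (map word_twist ws) (corner_pair 0 ++ map word_twist ws').
    rewrite ews map_cat /= ex ey.
    apply: Hurwitz_trans (Hurwitz_pass_pair _ _ _ _) _.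
    rewrite mul_corner_pair -map_comp.
    rewrite (eq_map (g := word_twist \o fun w => (w.1.+2, w.2))); last first.
      by move=> w /=; rewrite word_twist_conj_rho.
    rewrite map_comp -map_cat.
    exact: (Hurwitz_cat [::] _ (Hurwitz_corner_pair i)).
  have [||m eqm] := IHn ws' k.+1.
  - move: sn; rewrite ews !total_depth_cat !total_depth_cons.
    have -> : total_depth [seq (w.1.+2, w.2) | w <- w1] = total_depth w1.
      by rewrite /total_depth size_map -map_comp.
    by lia.
  - rewrite -[RHS]e1 (Hurwitz_prod eqv) big_cat prod_corner_pair.
    by rewrite expgSr -mulgA.
  exists m.+1; apply: Hurwitz_trans eqv _.
  have := Hurwitz_cat (corner_pair 0) [::] eqm; rewrite !cats0; exact.
- move=> [l ltl [v sv ev]]; apply: (IHs (w1 ++ [:: y, v & w2])).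
    by rewrite ews !total_depth_cat !total_depth_cons; lia.
  rewrite ews !map_cat /= -ev; apply: rst_step; exact: HurwitzStep.
- move=> [l ltl [v sv ev]]; apply: (IHs (w1 ++ [:: v, x & w2])).
    by rewrite ews !total_depth_cat !total_depth_cons; lia.
  rewrite ews !map_cat /= -ev; apply: Hurwitz_sym; apply: rst_step.
  rewrite -[X in Hurwitz_step _ (_ ++ [:: _, X & _])](conjgKV (word_twist x)).
  exact: HurwitzStep.
Qed.

(** * Classification of genus one Lefschetz fibrations *)

Lemma fibration_standard (F : genus1_Lefschetz_fibration) :
  exists2 m, 6 %| m & Hurwitz_equiv (monodromy F) (standard_factorization m).
Proof.
have [ws ews] := Dehn_twists_words (@monodromy_twist F).
have [|m eqm] := @Hurwitz_standard _ ws 0 (leqnn _).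
  by rewrite mul1g -ews monodromy_prod.
exists m; last by rewrite ews.
by apply: rhoX_eq1; rewrite -prod_standard -(Hurwitz_prod eqm) -ews monodromy_prod.
Qed.

Lemma isomorphic_size F1 F2 :
  isomorphic F1 F2 ->
  number_of_singular_fibers F1 = number_of_singular_fibers F2.
Proof.
rewrite /isomorphic /number_of_singular_fibers.
elim=> {F1 F2} [_ _ [s1 s2 x y|s g]|//|s t _ ->//|s t u _ -> _ -> //].
  by rewrite !size_cat.
by rewrite size_map.
Qed.

Lemma Hurwitz_isomorphic F1 F2 :
  Hurwitz_equiv (monodromy F1) (monodromy F2) -> isomorphic F1 F2.
Proof.
rewrite /isomorphic.
elim=> {F1 F2} [_ _ [s1 s2 x y]|s|s t _ IH|s t u _ IH1 _ IH2].
- exact/rst_step/Hurwitz_move.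
- exact: rst_refl.
- exact: rst_sym.
- exact: rst_trans IH1 IH2.
Qed.

Theorem theorem1p5 :
  (forall F1 F2 : genus1_Lefschetz_fibration,
      isomorphic F1 F2
      <-> number_of_singular_fibers F1 = number_of_singular_fibers F2)
  /\ (forall F : genus1_Lefschetz_fibration,
        12 %| number_of_singular_fibers F).
Proof.
split=> [F1 F2|F].
  split=> [|eqF]; first exact: isomorphic_size.
  have [m1 _ eq1] := fibration_standard F1.
  have [m2 _ eq2] := fibration_standard F2.
  apply: Hurwitz_isomorphic; apply: (Hurwitz_trans eq1).
  suff -> : m1 = m2 by apply: Hurwitz_sym.
  have := eqF; rewrite /number_of_singular_fibers.
  by rewrite (Hurwitz_size eq1) (Hurwitz_size eq2) !size_standard; lia.
have [m m6 eqm] := fibration_standard F.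
rewrite /number_of_singular_fibers (Hurwitz_size eqm) size_standard.
by rewrite (@dvdn_pmul2l 2 6).
Qed.
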